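(* Let $\theta=\sigma\circ\sigma_c$ be the Cartan involution of $G$, and suppose that $G$ is part of an extended group $1\to G\to{}^{\mathrm{ex}}G\to\{1,\delta\}\to1$ such that $$\theta=\operatorname{Int}(\xi)|_G,\qquad \xi\in{}^{\mathrm{ex}}G-G,\qquad \xi^2=z\in Z(G).$$ Then a finite-dimensional irreducible algebraic representation $(\pi,E)$ of $G$ admits a (nonzero) $\sigma$-invariant Hermitian form if and only if $\pi$ has an extension $\Pi$ to ${}^{\mathrm{ex}}G$. In that case, define a nonzero complex scalar $z_\pi$ by $\pi(z)=z_\pi I_E$ and choose a square root $\omega_\pi$ of $z_\pi$. Then the $\sigma$-invariant Hermitian form on $E$ may be taken to be $$\langle v,w\rangle=\langle v,\omega_\pi^{-1}\Pi(\xi)w\rangle_c .$$ The signature of this form is $$\bigl(\text{$+1$ eigenspace of $\omega_\pi^{-1}\Pi(\xi)$},\ \text{$-1$ eigenspace of $\omega_\pi^{-1}\Pi(\xi)$}\bigr).$$ In particular, the difference between the dimensions of the positive and negative parts is equal to $\omega_\pi^{-1}$ times the character value $\operatorname{tr}(\Pi(\xi))$.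
   Context: $G$ is a complex connected reductive algebraic group; $\sigma$ is a real form of $G$, i.e. an antiholomorphic automorphism of order two; $\sigma_c$ is a compact real form of $G$ (an antiholomorphic order two automorphism with compact fixed point group) commuting with $\sigma$; $\theta=\sigma\circ\sigma_c=\sigma_c\circ\sigma$ is the corresponding Cartan involution, an algebraic automorphism with $\theta^2=1$. For $\sigma'\in\{\sigma,\sigma_c\}$, a Hermitian form $\langle\cdot,\cdot\rangle$ (linear in the first variable, conjugate linear in the second) on a representation $(\pi,E)$ of $G$ is $\sigma'$-invariant if $\langle\pi(g)v,w\rangle=\langle v,\pi(\sigma'(g))^{-1}w\rangle$ for all $g\in G$, $v,w\in E$. $\langle\cdot,\cdot\rangle_c$ denotes a positive definite $\sigma_c$-invariant Hermitian form on $E$ (it exists and is unique up to positive scalar). An extended group for $G$ is a group ${}^{\mathrm{ex}}G$ containing $G$ as a normal subgroup with quotient a two-element group $\{1,\delta\}$; $\operatorname{Int}(\xi)$ is conjugation by $\xi$; an extension of $\pi$ to ${}^{\mathrm{ex}}G$ is a representation of ${}^{\mathrm{ex}}G$ on $E$ restricting to $\pi$ on $G$. The signature of a nondegenerate Hermitian form is recorded as (positive part, negative part); these parts are representations of $K=G^\theta$. *)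

(* Defs.v *)
From HB Require Import structures.
From mathcomp Require Import all_boot all_order all_algebra.
From mathcomp Require Import sesquilinear complex.
From mathcomp Require Import all_classical all_reals all_analysis.
From mathcomp Require mpoly.

Set Implicit Arguments.
Unset Strict Implicit.
Unset Printing Implicit Defensive.

Import Order.TTheory GRing.Theory Num.Theory.
Import numFieldNormedType.Exports.

Local Open Scope classical_set_scope.
Local Open Scope ring_scope.

(* The definitions are stated over an arbitrary [C : numClosedFieldType], with
   the topology given by its norm; they are meant for [C = R[i]], [R] the field
   of real numbers. *)

Definition mx_eval (C : fieldType) (n : nat) (p : mpoly.mpoly (n * n) C)
    (M : 'M[C]_n) : C :=
  mpoly.meval (fun k => mxvec M 0 k) p.

(* A linear algebraic group: a group [G] realized as a Zariski closed subgroup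
   of GL_n(C). *)
Structure algGroup (C : fieldType) := AlgGroup {
  alg_sort :> groupType;
  alg_dim : nat;
  alg_mx : alg_sort -> 'M[C]_alg_dim;
  alg_mx1 : alg_mx 1%g = 1%:M;
  alg_mxM : forall g h, alg_mx (g * h)%g = alg_mx g *m alg_mx h;
  alg_mx_inj : injective alg_mx;
  alg_mx_closed : exists S : set (mpoly.mpoly (alg_dim * alg_dim) C),
    range alg_mx =
    [set M | M \in unitmx /\ forall p, S p -> mx_eval p M = 0]
}.

Section AlgebraicGroups.
Variables (C : fieldType) (G : algGroup C).

Definition zariski_closed (A : set G) : Prop :=
  exists S : set (mpoly.mpoly (alg_dim G * alg_dim G) C),
    A = [set g | forall p, S p -> mx_eval p (alg_mx g) = 0].

(* The regular functions on a closed subset of GL_n(C) are the restrictions of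
   elements of C[x_ij, 1/det]. *)
Definition regular_fun (f : G -> C) : Prop :=
  exists (p : mpoly.mpoly (alg_dim G * alg_dim G) C) (k : nat),
    forall g, f g = mx_eval p (alg_mx g) / \det (alg_mx g) ^+ k.

Definition zariski_connected (A : set G) : Prop :=
  forall B1 B2 : set G, zariski_closed B1 -> zariski_closed B2 ->
    A `<=` B1 `|` B2 -> A `&` B1 `&` B2 = set0 -> A `<=` B1 \/ A `<=` B2.

Definition is_subgroup (U : set G) : Prop :=
  U 1%g /\ forall x y, U x -> U y -> U (x * y^-1)%g.

Definition is_normal (U : set G) : Prop := forall g x, U x -> U (x ^ g)%g.

Definition unipotent (g : G) : Prop :=
  exists k : nat, (alg_mx g - 1%:M) ^+ k = 0.

(* The unipotent radical is trivial. *)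
Definition reductive : Prop :=
  forall U : set G, is_subgroup U -> is_normal U -> zariski_closed U ->
    zariski_connected U -> (forall u, U u -> unipotent u) -> U `<=` [set 1%g].

Definition connected_reductive : Prop :=
  zariski_connected [set: G] /\ reductive.

End AlgebraicGroups.

Section RealForms.
Variables (C : numClosedFieldType) (G : algGroup C).

(* [G] is a closed complex submanifold of the open subset GL_n(C) of the matrix
   space, so a map out of [G] is holomorphic iff it locally extends to a
   holomorphic (complex differentiable) map on the ambient space; a map is
   antiholomorphic iff it is the conjugate of a holomorphic one. *)
Definition antiholomorphic (f : G -> G) : Prop :=
  forall g0 : G, exists F : 'M[C]_(alg_dim G) -> 'M[C]_(alg_dim G),
    (\forall M \near alg_mx g0, differentiable F M) /\
    (\forall M \near alg_mx g0, forall g : G, alg_mx g = M ->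
       alg_mx (f g) = map_mx Num.conj (F M)).

(* "Order two" means sigma^2 = 1: an antiholomorphic map is not the identity
   unless G is trivial. *)
Definition real_form (sigma : {multiplicative G -> G}) : Prop :=
  involutive sigma /\ antiholomorphic sigma.

Definition compact_real_form (sigma : {multiplicative G -> G}) : Prop :=
  real_form sigma /\ compact (@alg_mx C G @` [set g | sigma g = g]).

End RealForms.

(* An extension 1 -> G -> exG -> {1, delta} -> 1; the two-element group
   {1, delta} is [(bool, addb)], with delta = true. *)
Structure extendedGroup (G : groupType) := ExtendedGroup {
  ex_sort :> groupType;
  ex_incl : {multiplicative G -> ex_sort};
  ex_incl_inj : injective ex_incl;
  ex_proj : ex_sort -> bool;
  ex_projM : forall x y, ex_proj (x * y)%g = ex_proj x (+) ex_proj y;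
  ex_proj_surj : exists x, ex_proj x = true;
  ex_exact : range ex_incl = [set x | ex_proj x = false]
}.

Section Representations.
Variables (C : fieldType) (E : vectType C).

Definition is_representation (H : groupType) (pi : H -> 'End(E)) : Prop :=
  pi 1%g = \1%VF /\ forall g h, pi (g * h)%g = (pi g \o pi h)%VF.

Definition stable (H : groupType) (pi : H -> 'End(E)) (K : set H)
    (W : {vspace E}) : Prop :=
  forall k, K k -> (pi k @: W <= W)%VS.

Definition irreducible (H : groupType) (pi : H -> 'End(E)) : Prop :=
  (fullv : {vspace E}) <> 0%VS /\
  forall W : {vspace E}, stable pi [set: H] W -> W = 0%VS \/ W = fullv.

Definition algebraic_rep (G : algGroup C) (pi : G -> 'End(E)) : Prop :=
  is_representation pi /\
  forall (phi : {scalar E}) (v : E), regular_fun (fun g => phi (pi g v)).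

Definition is_extension (G : groupType) (exG : extendedGroup G)
    (pi : G -> 'End(E)) (Pi : exG -> 'End(E)) : Prop :=
  is_representation Pi /\ forall g, Pi (ex_incl exG g) = pi g.

Definition lftrace (f : 'End(E)) : C :=
  \tr (passmx.mxof (vbasis {:E}) (vbasis {:E}) f).

End Representations.

Section Forms.
Variables (C : numClosedFieldType) (E : vectType C).

Definition invariant_form (G : groupType) (pi : G -> 'End(E)) (s : G -> G)
    (h : {hermitian E for false & Num.conj}) : Prop :=
  forall g v w, h (pi g v) w = h v (pi (s g)^-1%g w).

Definition nonzero_form (h : {hermitian E for false & Num.conj}) : Prop :=
  exists v w, h v w != 0.

(* [P] and [N] realize the signature of [h] as a pair of representations of
   [K]: they span an [h]-orthogonal direct sum decomposition of [E] into
   [K]-stable subspaces, with [h] positive on [P] and negative on [N].  Such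
   [P] and [N] are unique up to isomorphism of representations of [K]. *)
Definition signature (G : groupType) (pi : G -> 'End(E)) (K : set G)
    (h : {hermitian E for false & Num.conj}) (P N : {vspace E}) : Prop :=
  [/\ (P + N)%VS = fullv /\ (P :&: N)%VS = 0%VS,
      stable pi K P /\ stable pi K N,
      forall v w, v \in P -> w \in N -> h v w = 0,
      forall v, v \in P -> v != 0 -> 0 < h v v &
      forall v, v \in N -> v != 0 -> h v v < 0].

End Forms.

(* Main.v *)
Require Import Defs.
From HB Require Import structures.
From mathcomp Require Import all_boot all_order all_algebra.
From mathcomp Require Import sesquilinear complex spectral.
From mathcomp Require Import all_classical all_reals all_analysis.

Set Implicit Arguments.
Unset Strict Implicit.
Unset Printing Implicit Defensive.

Import Order.TTheory GRing.Theory Num.Theory.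
Import numFieldNormedType.Exports.

(** Write [<v, w>_c] for the compact form [form_c].  Everything follows from
Schur's lemma applied to operators that intertwine [pi] with its twist
[pi \o theta].

From a form to an extension ([extension_of_form]).  As [<,>_c] is
nondegenerate, a sigma-invariant form is [<v, T w>_c] for a linear [T]
([sesquilinear_riesz]).  Comparing the two invariance properties, one for
[sigma] and one for [sigma_c], gives [T (pi g) = pi (theta g) T].  Hence [T] is
invertible and [T^2], which commutes with [pi], is a scalar; rescaling [T] by a
complex number makes its square equal to [pi z].  The rescaled [T] can then be
taken as [Pi xi]: the coset decomposition of the extended group, together with
[xi g = theta(g) xi] and [xi^2 = z], makes this a representation
([extension_of_intertwiner]).

From an extension to a form ([form_of_extension]).  The operator
[J = omega^-1 Pi xi] satisfies [J^2 = 1] and [J (pi g) = pi (theta g) J].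
The point is that [<v, J w>_c] is Hermitian, that is, that [J] is self-adjoint
([involution_selfadjoint]).  Since [theta] commutes with [sigma_c], the form
[<J v, J w>_c] is again sigma_c-invariant, so by Schur it is a multiple of
[<v, w>_c]; the factor is nonnegative by positivity and has square 1 because
[J^2 = 1], so it is 1.  Thus [J] is unitary and an involution, hence
self-adjoint.

Signature.  A self-adjoint involution has orthogonal eigenspaces for 1 and -1,
on which the form is [<v, v>_c] and [- <v, v>_c] ([signature_involution]).  By
Sylvester's law of inertia ([leq_dim_signature]) every other realization of the
signature has the same dimensions, and their difference is the trace of [J]
([lftrace_involution]). *)

Local Open Scope classical_set_scope.
Local Open Scope ring_scope.

Import passmx.

(** * Traces of projections and involutions *)

Section Trace.
Variable C : fieldType.

(** A projection factors as the inclusion [i] of its image after a retraction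
[r]; by cyclicity its trace is that of [r \o i], the identity of the image. *)
Lemma lftrace_projection (E : vectType C) (U : {vspace E}) (p : 'End(E)) :
    (forall v, p v \in U) -> (forall v, v \in U -> p v = v) ->
  lftrace p = (\dim U)%:R.
Proof.
move=> pU p_id; pose e := vbasis {:E}; pose f := vbasis {:subvs_of U}.
have e_basis : basis_of {:E} e := vbasisP _.
have f_basis : basis_of {:subvs_of U} f := vbasisP _.
pose i : 'Hom(subvs_of U, E) := linfun vsval.
pose r : 'Hom(E, subvs_of U) := (linfun (vsproj U) \o p)%VF.
have iE u : i u = vsval u by rewrite lfunE.
have rE v : r v = vsproj U (p v) by rewrite comp_lfunE lfunE.
have -> : p = (i \o r)%VF.
  by apply/lfunP=> v; rewrite comp_lfunE iE rE vsprojK.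
have ri : (r \o i)%VF = \1%VF.
  by apply/lfunP=> u; rewrite comp_lfunE iE rE p_id ?subvsP// vsvalK lfunE.
rewrite /lftrace (mxof_comp e e f_basis) mxtrace_mulC.
by rewrite -(mxof_comp f f e_basis) ri mxof1 ?(basis_free f_basis)// mxtrace1 dimvf.
Qed.

End Trace.

Section Involution.
Variables (C : numFieldType) (E : vectType C) (J : 'End(E)).
Hypothesis J2 : forall v, J (J v) = v.

Lemma mem_leigenspace a v : (v \in leigenspace J a) = (J v == a *: v).
Proof. by rewrite memv_ker add_lfunE opp_lfunE scale_lfunE id_lfunE subr_eq0. Qed.

(** [J] is the difference of the projections [(1 + J) / 2] and [(1 - J) / 2]
onto its two eigenspaces. *)
Lemma lftrace_involution :
  lftrace J = (\dim (leigenspace J 1))%:R - (\dim (leigenspace J (-1)))%:R.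
Proof.
(* For a = 1 or -1, p a projects onto the a-eigenspace. *)
pose p a : 'End(E) := 2^-1 *: (\1%VF + a *: J).
have pE a v : p a v = 2^-1 *: (v + a *: J v).
  by rewrite scale_lfunE add_lfunE scale_lfunE id_lfunE.
have half (v : E) : 2^-1 *: (v + v) = v.
  by rewrite -[v + v]mulr2n -[v *+ 2]scaler_nat scalerA mulVf ?pnatr_eq0// scale1r.
have tr_p a : a * a = 1 -> lftrace (p a) = (\dim (leigenspace J a))%:R.
  move=> aa; apply: lftrace_projection => v; rewrite ?mem_leigenspace !pE.
    rewrite linearZ linearD linearZ/= J2 scalerA (mulrC a) -scalerA.
    by rewrite [a *: (v + _)]scalerDr scalerA aa scale1r addrC.
  by move/eqP->; rewrite scalerA aa scale1r half.
rewrite -(tr_p 1) ?mulr1// -(tr_p (-1)) ?mulrNN ?mulr1//.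
rewrite /lftrace -raddfB -raddfB/=; congr (\tr (mxof _ _ _)); apply/lfunP=> v.
rewrite add_lfunE opp_lfunE !pE -scalerBr scale1r scaleN1r.
by rewrite opprD opprK addrACA subrr add0r half.
Qed.

End Involution.

(** * Schur's lemma *)

Section Schur.
Variables (C : numClosedFieldType) (E : vectType C) (G : groupType).
Variable pi : G -> 'End(E).
Hypothesis pi_irr : irreducible pi.

Lemma irreducible_neq0 : exists v : E, v != 0.
Proof.
have [/eqP E0 _] := pi_irr; exists (vpick {:E}).
by rewrite vpick0.
Qed.

(** The twist [t] lets the lemma apply to intertwiners between [pi] and
[pi \o theta] as well as to commuting operators. *)
Lemma schur_lker0 (t : G -> G) (T : 'End(E)) : T != 0 ->
    (forall g v, T (pi g v) = pi (t g) (T v)) ->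
  lker T == 0%VS.
Proof.
move=> T0 Tpi; have [_ /(_ (lker T))[]] := pi_irr.
- move=> g _; apply/subvP=> _ /memv_imgP[v vT ->]; move: vT.
  by rewrite !memv_ker Tpi => /eqP->; rewrite linear0.
- by move/eqP.
move=> kT; case/eqP: T0; apply/lfunP=> v; rewrite lfunE/=.
by apply/eqP; rewrite -memv_ker kT memvf.
Qed.

Lemma schur_scalar (T : 'End(E)) :
    (forall g v, T (pi g v) = pi g (T v)) ->
  exists a, forall v, T v = a *: v.
Proof.
move=> Tpi; have [v0 v0_neq0] := irreducible_neq0.
have E_gt0 : (0 < \dim {:E})%N.
  rewrite lt0n dimv_eq0; apply: contra_neq v0_neq0 => E0.
  by apply/eqP; rewrite -memv0 -E0 memvf.
have e_basis : basis_of {:E} (vbasis {:E}) := vbasisP _.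
have [a] := eigenvalue_closed (mxof (vbasis {:E}) (vbasis {:E}) T) E_gt0.
rewrite /eigenvalue -(vsof_eq0 e_basis) -(leigenspaceE e_basis) => Ea.
exists a => v.
have [//|T_neq0] := eqVneq (T - a *: \1%VF) 0.
  by move/eqP; rewrite subr_eq0 => /eqP->; rewrite scale_lfunE id_lfunE.
case/negP: Ea; apply: (schur_lker0 (t := id)) T_neq0 _ => g w.
rewrite !(add_lfunE, opp_lfunE, scale_lfunE, id_lfunE) Tpi.
by rewrite [RHS]linearB [in RHS]linearZ.
Qed.

End Schur.

(** * Sesquilinear forms relative to a positive definite one *)

Section Forms.
Variables (C : numClosedFieldType) (E : vectType C).
Variable dot : {dot E for Num.conj}.

(* Stated directly for the coercions of [h] and [dot], the identities below
   rewrite terms in the form in which they occur in goals. *)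
Lemma hermitianC (h : {hermitian E for false & Num.conj}) v w :
  h v w = (h w v)^*.
Proof. by rewrite hermC expr0 mul1r. Qed.

Lemma dotC v w : dot v w = (dot w v)^*.
Proof. exact: hermitianC. Qed.

Lemma hermitian_linearr (h : {hermitian E for false & Num.conj}) v a w w' :
  h v (a *: w + w') = a^* * h v w + h v w'.
Proof. exact: linearPr. Qed.

Lemma hermitian_linearl (h : {hermitian E for false & Num.conj}) w a v v' :
  h (a *: v + v') w = a * h v w + h v' w.
Proof. exact: linearPl. Qed.

Lemma dot_linearr v a w w' : dot v (a *: w + w') = a^* * dot v w + dot v w'.
Proof. exact: hermitian_linearr. Qed.

Lemma dot_linearl w a v v' : dot (a *: v + v') w = a * dot v w + dot v' w.
Proof. exact: hermitian_linearl. Qed.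

Lemma dot0r v : dot v 0 = 0.
Proof.
by have := dot_linearr v (-1) 0 0; rewrite scaler0 addr0 rmorphN1 mulN1r addNr.
Qed.

Lemma dotZr v a w : dot v (a *: w) = a^* * dot v w.
Proof. by have := dot_linearr v a w 0; rewrite dot0r !addr0. Qed.

Lemma dot_inj v w : (forall u, dot u v = dot u w) -> v = w.
Proof.
move=> vw; apply/eqP; rewrite -subr_eq0 -(dnorm_eq0 dot).
by rewrite -[v - w]addrC -scaleN1r dot_linearr vw rmorphN1 mulN1r addNr.
Qed.

Lemma lfun_of_linear (f : E -> E) : linear f ->
  exists F : 'End(E), forall v, F v = f v.
Proof.
move=> fl; pose F : {linear E -> E} := HB.pack f
  (GRing.isSemilinear.Build _ _ _ _ _ (GRing.semilinear_linear fl)).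
by exists (linfun F) => v; rewrite lfunE.
Qed.

(** Let [A_k w] be the vector with coordinates [(k b_i w)^*], [b] a basis of
[E].  It is linear in [w] and determines the functional [k _ w].  For [k = dot]
definiteness makes [A_k] injective, hence invertible, and
[T = A_dot^-1 \o A_h]. *)
Lemma sesquilinear_riesz (h : E -> E -> C) :
    (forall w a v v', h (a *: v + v') w = a * h v w + h v' w) ->
    (forall v a w w', h v (a *: w + w') = a^* * h v w + h v w') ->
  exists T : 'End(E), forall v w, h v w = dot v (T w).
Proof.
move=> hl hr; pose b := vbasis {:E}.
have b_basis : basis_of {:E} b := vbasisP _.
pose A (k : E -> E -> C) w : E := \sum_(i < \dim {:E}) (k b`_i w)^* *: b`_i.
have coordA k w i : coord b i (A k w) = (k b`_i w)^*.
  by rewrite coord_sum_free// (basis_free b_basis).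
have A_linear k : (forall v a w w', k v (a *: w + w') = a^* * k v w + k v w') ->
    exists F : 'End(E), forall w, F w = A k w.
  move=> kr; apply: lfun_of_linear => a w w'.
  rewrite /A scaler_sumr -big_split/=; apply: eq_bigr => i _.
  by rewrite kr rmorphD rmorphM/= conjCK scalerDl scalerA.
have [AD ADE] := A_linear _ dot_linearr; have [AH AHE] := A_linear _ hr.
have expand (k : E -> E -> C) v w :
    (forall x a u u', k (a *: u + u') x = a * k u x + k u' x) ->
    k v w = \sum_i coord b i v * k b`_i w.
  move=> kl; have k0 : k 0 w = 0.
    by have := kl w (-1) 0 0; rewrite scaler0 addr0 mulN1r addNr.
  rewrite {1}(coord_basis b_basis (memvf v)).
  by elim/big_rec2: _ => [//|i y x _ <-]; rewrite kl.
have kerAD : lker AD == 0%VS.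
  rewrite -subv0; apply/subvP=> w; rewrite memv_ker memv0 ADE => /eqP Aw.
  rewrite -(dnorm_eq0 dot) (expand _ _ _ dot_linearl) big1// => i _.
  by rewrite -[dot _ w]conjCK -coordA Aw linear0 conjC0 mulr0.
exists (AD^-1 \o AH)%VF => v w.
rewrite (expand _ _ _ hl) (expand _ _ _ dot_linearl); apply: eq_bigr => i _.
congr (_ * _); apply: (can_inj conjCK); rewrite -!coordA.
by rewrite -AHE -ADE comp_lfunE lker0_lfunVK.
Qed.

Lemma hermitian_of_selfadjoint (J : 'End(E)) :
    (forall v w, dot (J v) w = dot v (J w)) ->
  exists h : {hermitian E for false & Num.conj}, forall v w, h v w = dot v (J w).
Proof.
move=> Jadj; pose f v w := dot v (J w).
have fbi : bilinear_for *%R (Num.conj \; *%R) f.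
  split=> [w a v v'|v a w w']; rewrite /f.
    exact: dot_linearl.
  by rewrite linearP dot_linearr.
have fherm v w : f v w = (-1) ^+ false * (f w v)^*.
  by rewrite /f expr0 mul1r -dotC Jadj.
pose h : {hermitian E for false & Num.conj} := HB.pack f
  (bilinear_isBilinear.Build _ _ _ _ _ _ f fbi)
  (isHermitianSesquilinear.Build _ _ _ _ f fherm).
by exists h.
Qed.

End Forms.

(** * Invariant forms and intertwining operators *)

Section GroupMorphism.
Variables (G H : groupType) (f : {multiplicative G -> H}).

(** The structure of [f] records products only; for groups, cancellation gives
the unit and inverses. *)
Lemma multiplicative1 : f 1%g = 1%g.
Proof. by apply: (@mulIg _ (f 1%g)); rewrite -gmulfM !mul1g. Qed.

Lemma multiplicativeV g : f g^-1%g = (f g)^-1%g.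
Proof.
by apply: (@mulIg _ (f g)); rewrite -gmulfM !mulVg multiplicative1.
Qed.

End GroupMorphism.

Section Representation.
Variables (C : fieldType) (E : vectType C) (G : groupType).
Variable pi : G -> 'End(E).
Hypothesis pi_rep : is_representation pi.

Lemma representationM g h v : pi (g * h)%g v = pi g (pi h v).
Proof. by rewrite pi_rep.2 comp_lfunE. Qed.

Lemma representation1 v : pi 1%g v = v.
Proof. by rewrite pi_rep.1 id_lfunE. Qed.

Lemma representationKV g v : pi g^-1%g (pi g v) = v.
Proof. by rewrite -representationM mulVg representation1. Qed.

End Representation.

Section InvariantForms.
Variables (C : numClosedFieldType) (E : vectType C) (G : groupType).
Variable pi : G -> 'End(E).
Hypothesis pi_irr : irreducible pi.
Variable dot : {dot E for Num.conj}.

(** This is used both with [s' = s], where it feeds Schur's lemma and yields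
the uniqueness of invariant forms, and with two different real forms, where it
yields an operator intertwining [pi] with its twist by their composite. *)
Lemma invariant_forms_intertwine (s s' : G -> G) (h : E -> E -> C)
    (T : 'End(E)) :
    invariant_form pi s dot ->
    (forall g v w, h (pi g v) w = h v (pi (s' g)^-1%g w)) ->
    (forall v w, h v w = dot v (T w)) ->
  forall g w, T (pi (s' g)^-1%g w) = pi (s g)^-1%g (T w).
Proof.
move=> dot_inv h_inv hT g w; apply: (dot_inj (dot := dot)) => v.
by rewrite -hT -h_inv hT dot_inv.
Qed.

(** The form [<J v, J w>] is again [s]-invariant because [t] commutes with
[s], so Schur's lemma gives [<J v, J w> = c <v, w>].  Positivity gives [c >= 0]
and [J^2 = 1] gives [c^2 = 1], so [J] is unitary; a unitary involution is
self-adjoint. *)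
Lemma involution_selfadjoint (s : {multiplicative G -> G}) (t : G -> G)
    (J : 'End(E)) :
    invariant_form pi s dot -> involutive s ->
    (forall g, t (s g)^-1%g = (s (t g))^-1%g) ->
    (forall v, J (J v) = v) -> (forall g v, J (pi g v) = pi (t g) (J v)) ->
  forall v w, dot (J v) w = dot v (J w).
Proof.
move=> dot_inv sK st J2 Jpi.
pose h v w := dot (J v) (J w).
have h_inv g v w : h (pi g v) w = h v (pi (s g)^-1%g w).
  by rewrite /h !Jpi dot_inv st.
have [T hT] : exists T : 'End(E), forall v w, h v w = dot v (T w).
  apply: sesquilinear_riesz => [w a v v'|v a w w']; rewrite /h linearP.
    exact: dot_linearl.
  exact: dot_linearr.
have Tpi g w : T (pi g w) = pi g (T w).
  (* At s (g^-1) the operator pi (s _)^-1 is pi g. *)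
  have := invariant_forms_intertwine dot_inv h_inv hT (s g^-1%g) w.
  by rewrite sK invgK.
have [a Ta] := schur_scalar pi_irr Tpi.
have [v0 v0_neq0] := irreducible_neq0 pi_irr.
have ha v w : dot (J v) (J w) = a^* * dot v w by rewrite -dotZr -Ta -hT.
have dv0 : 0 < dot v0 v0 by rewrite dnorm_gt0.
have a_ge0 : 0 <= a^*.
  have : 0 <= dot (J v0) (J v0) by exact: dnorm_ge0.
  by rewrite ha pmulr_lge0.
have a2 : a^* ^+ 2 = 1.
  apply: (mulIf (lt0r_neq0 dv0)).
  by rewrite mul1r expr2 -mulrA -!ha !J2.
have a1 : a^* = 1.
  by apply/eqP; rewrite -(@eqrXn2 _ 2) ?ler01// a2 expr1n.
by move=> v w; rewrite -{1}[w]J2 ha a1 mul1r.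
Qed.

End InvariantForms.

(** * Signatures *)

Section Signature.
Variables (C : numClosedFieldType) (E : vectType C) (G : groupType).
Variables (pi : G -> 'End(E)) (K : set G).
Variable h : {hermitian E for false & Num.conj}.

(** Sylvester's law of inertia: a positive and a negative subspace meet in 0,
so [\dim P + \dim N' <= \dim E = \dim P' + \dim N'].  Exchanging the two
decompositions turns the inequalities into equalities. *)
Lemma leq_dim_signature (P N P' N' : {vspace E}) :
  signature pi K h P N -> signature pi K h P' N' ->
  (\dim P <= \dim P')%N /\ (\dim N <= \dim N')%N.
Proof.
have disj (A B : {vspace E}) : (forall v, v \in A -> v != 0 -> 0 < h v v) ->
    (forall v, v \in B -> v != 0 -> h v v < 0) ->
    (\dim A + \dim B <= \dim {:E})%N.
  move=> Apos Bneg; rewrite -dimv_disjoint_sum ?dimvS ?subvf//.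
  apply/eqP; rewrite -subv0; apply/subvP=> v; rewrite memv_cap memv0.
  case/andP=> vA vB; apply/negPn/negP => v_neq0.
  by have := lt_trans (Apos v vA v_neq0) (Bneg v vB v_neq0); rewrite ltxx.
move=> [[_ _] _ _ Ppos Nneg] [[PN' PNI'] _ _ Ppos' Nneg'].
have := dimv_disjoint_sum PNI'; rewrite PN' => dimE.
have := disj _ _ Ppos Nneg'; have := disj _ _ Ppos' Nneg.
by rewrite dimE leq_add2l leq_add2r.
Qed.

(** Self-adjointness makes the eigenspaces for 1 and -1 orthogonal, and [h] is
[dot] on the first and [- dot] on the second. *)
Lemma signature_involution (dot : {dot E for Num.conj}) (J : 'End(E)) :
    (forall v w, dot (J v) w = dot v (J w)) -> (forall v, J (J v) = v) ->
    (forall g v, K g -> J (pi g v) = pi g (J v)) ->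
    (forall v w, h v w = dot v (J w)) ->
  signature pi K h (leigenspace J 1) (leigenspace J (-1)).
Proof.
move=> Jadj J2 Jpi hJ.
have stab a : stable pi K (leigenspace J a).
  move=> k Kk; apply/subvP=> _ /memv_imgP[v + ->].
  by rewrite !mem_leigenspace Jpi// => /eqP->; rewrite linearZ.
have eigen_split v : v = 2^-1 *: (v + J v) + 2^-1 *: (v - J v).
  rewrite -scalerDr addrACA subrr addr0 -[v + v]mulr2n -[v *+ 2]scaler_nat.
  by rewrite scalerA mulVf ?pnatr_eq0// scale1r.
split; do ?split=> //.
- apply/eqP; rewrite eqEsubv subvf; apply/subvP=> v _; rewrite [v]eigen_split.
  rewrite memv_add// memvZ// mem_leigenspace linearD ?linearN/= J2.
    by rewrite scale1r addrC.
  by rewrite scaleN1r opprB addrC.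
- apply/eqP; rewrite -subv0; apply/subvP=> v; rewrite memv_cap memv0.
  rewrite !mem_leigenspace => /andP[/eqP-> /eqP]; rewrite scale1r scaleN1r.
  by move/eqP; rewrite -addr_eq0 -[v + v]mulr2n -[v *+ 2]scaler_nat scaler_eq0 pnatr_eq0.
- move=> v w; rewrite !mem_leigenspace scale1r scaleN1r => /eqP Jv /eqP Jw.
  have dvw : - dot v w = dot v w.
    by rewrite -[in RHS]Jv Jadj Jw -scaleN1r dotZr rmorphN1 mulN1r.
  rewrite hJ Jw -scaleN1r dotZr rmorphN1 mulN1r; apply/eqP.
  by rewrite dvw -[_ == 0](mulrn_eq0 _ 2) mulr2n -{1}dvw addNr.
- move=> v; rewrite mem_leigenspace scale1r => /eqP Jv v_neq0.
  by rewrite hJ Jv dnorm_gt0.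
move=> v; rewrite mem_leigenspace => /eqP Jv v_neq0.
by rewrite hJ Jv dotZr rmorphN1 mulN1r oppr_lt0 dnorm_gt0.
Qed.

End Signature.

(** * Extensions of a representation to an extended group *)

Section Extension.
Variables (G : groupType) (exG : extendedGroup G) (xi : exG) (z : G).
Variable theta : G -> G.
Hypothesis xi_out : ~ range (ex_incl exG) xi.
Hypothesis theta_Int : forall g,
  ex_incl exG (theta g) = (xi * ex_incl exG g * xi^-1)%g.
Hypothesis xi2 : (xi ^+ 2)%g = ex_incl exG z.
Variables (C : fieldType) (E : vectType C) (pi : G -> 'End(E)).

Lemma extension_twist Pi g v : is_extension pi Pi ->
  Pi xi (pi g v) = pi (theta g) (Pi xi v).
Proof.
move=> [Pi_rep Pi_pi]; rewrite -!Pi_pi -!(representationM Pi_rep).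
by rewrite theta_Int mulgVK.
Qed.

Lemma extension_sqr Pi v : is_extension pi Pi -> Pi xi (Pi xi v) = pi z v.
Proof.
by move=> [Pi_rep Pi_pi]; rewrite -Pi_pi -xi2 expg2 (representationM Pi_rep).
Qed.

(** An extension is determined by [S = Pi xi]: every element outside [G] is
uniquely [g xi] with [g] in [G], and goes to [pi g \o S].  The two hypotheses on
[S] mirror the relations [xi g = theta(g) xi] and [xi^2 = z], which suffice to
multiply such elements. *)
Lemma extension_of_intertwiner (S : 'End(E)) : is_representation pi ->
    (forall g v, S (pi g v) = pi (theta g) (S v)) ->
    (forall v, S (S v) = pi z v) ->
  exists Pi : exG -> 'End(E), is_extension pi Pi.
Proof.
move=> pi_rep Spi S2; pose e := ex_incl exG.
have proj_e g : ex_proj (e g) = false.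
  by have : range e (e g) by []; rewrite ex_exact.
have e1 : e 1%g = 1%g by exact: multiplicative1.
have proj_e_ex x : ex_proj x = false -> exists g, e g = x.
  move=> px; have [g _ <-] : range e x by rewrite ex_exact.
  by exists g.
have proj_xi : ex_proj xi = true.
  by case pxi: (ex_proj xi) => //; case: xi_out; rewrite ex_exact.
have proj_xiV : ex_proj xi^-1%g = true.
  have := proj_e 1%g; rewrite e1 -(mulgV xi) ex_projM proj_xi.
  by case: ex_proj.
(* r x is the component in G of x = r x or x = r x xi. *)
have /choice[r rE] :
    forall x, exists g, e g = if ex_proj x then (x * xi^-1)%g else x.
  move=> x; case: ifPn => [px|/negbTE px]; last exact: proj_e_ex.
  by apply: proj_e_ex; rewrite ex_projM px proj_xiV.
pose Pi x := if ex_proj x then (pi (r x) \o S)%VF else pi (r x).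
have r_e g : r (e g) = g.
  by apply: (@ex_incl_inj _ exG); rewrite -/e rE proj_e.
exists Pi; split=> [|g]; last by rewrite /Pi proj_e r_e.
split=> [|x y].
  by have := proj_e 1%g; have := r_e 1%g; rewrite /Pi e1 => -> ->; rewrite pi_rep.1.
have r_uniq u g : e g = (if ex_proj u then (u * xi^-1)%g else u) -> r u = g.
  by move=> eg; apply: (@ex_incl_inj _ exG); rewrite -/e rE.
have eM g h : e (g * h)%g = (e g * e h)%g by exact: gmulfM.
have e_theta g : e (theta g) = (xi * e g * xi^-1)%g by exact: theta_Int.
have piM := representationM pi_rep.
apply/lfunP=> v; rewrite /Pi comp_lfunE.
have := rE x; have := rE y; have := r_uniq (x * y)%g; rewrite ex_projM.
case: (ex_proj x); case: (ex_proj y) => /= rxy ey ex.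
- rewrite (rxy (r x * theta (r y) * z)%g); last first.
    by rewrite !eM e_theta ex ey -[e z]xi2 expg2 !mulgA !mulgVK.
  by rewrite !comp_lfunE !piM Spi S2.
- rewrite (rxy (r x * theta (r y))%g); last first.
    by rewrite eM e_theta ex ey !mulgA mulgVK.
  by rewrite !comp_lfunE !piM Spi.
- rewrite (rxy (r x * r y)%g); last by rewrite eM ex ey mulgA.
  by rewrite !comp_lfunE !piM.
- by rewrite (rxy (r x * r y)%g) ?piM// eM ex ey.
Qed.

End Extension.

(** * Sigma-invariant forms and extensions *)

Section ExtendedGroupForms.
Variables (C : numClosedFieldType) (G : groupType).
Variables (sigma sigma_c : {multiplicative G -> G}) (theta : G -> G).
Hypothesis sigmaK : involutive sigma.
Hypothesis sigma_cK : involutive sigma_c.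
Hypothesis sigmaC : forall g, sigma (sigma_c g) = sigma_c (sigma g).
Hypothesis thetaE : forall g, theta g = sigma (sigma_c g).
Variables (exG : extendedGroup G) (xi : exG) (z : G).
Hypothesis xi_out : ~ range (ex_incl exG) xi.
Hypothesis theta_Int : forall g,
  ex_incl exG (theta g) = (xi * ex_incl exG g * xi^-1)%g.
Hypothesis xi2 : (xi ^+ 2)%g = ex_incl exG z.
Variables (E : vectType C) (pi : G -> 'End(E)).
Hypothesis pi_rep : is_representation pi.
Hypothesis pi_irr : irreducible pi.
Variable form_c : {dot E for Num.conj}.
Hypothesis form_c_inv : invariant_form pi sigma_c form_c.

Lemma central_scalar : (forall g, commute z g) ->
  exists2 a, a != 0 & forall v, pi z v = a *: v.
Proof.
move=> z_central; have piM := representationM pi_rep.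
have [a pi_z] : exists a, forall v, pi z v = a *: v.
  by apply: (schur_scalar pi_irr) => g v; rewrite -!piM z_central.
have [v0 v0_neq0] := irreducible_neq0 pi_irr.
exists a => //; apply: contra_neq v0_neq0 => a0.
by rewrite -(representationKV pi_rep z v0) pi_z a0 scale0r linear0.
Qed.

Variable z_pi : C.
Hypothesis z_pi_neq0 : z_pi != 0.
Hypothesis pi_z : forall v, pi z v = z_pi *: v.

Lemma form_of_extension (Pi : exG -> 'End(E)) (omega : C) :
    is_extension pi Pi -> omega ^+ 2 = z_pi ->
    let J : 'End(E) := omega^-1 *: Pi xi in
  exists h : {hermitian E for false & Num.conj},
    [/\ forall v w, h v w = form_c v (J w),
        nonzero_form h,
        invariant_form pi sigma h,
        signature pi [set g | theta g = g] h
          (leigenspace J 1) (leigenspace J (-1)) &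
        forall P N : {vspace E}, signature pi [set g | theta g = g] h P N ->
          (\dim P)%:R - (\dim N)%:R = omega^-1 * lftrace (Pi xi)].
Proof.
move=> ext omega2 J.
have omega_neq0 : omega != 0.
  by apply: contra_neq z_pi_neq0 => omega0; rewrite -omega2 omega0 expr0n.
have JE v : J v = omega^-1 *: Pi xi v by rewrite scale_lfunE.
have J2 v : J (J v) = v.
  rewrite !JE linearZ/= (extension_sqr xi2 v ext) pi_z !scalerA -omega2.
  by rewrite -expr2 -exprMn mulVf// expr1n scale1r.
have Jpi g v : J (pi g v) = pi (theta g) (J v).
  by rewrite !JE (extension_twist theta_Int g v ext) linearZ.
have Jadj : forall v w, form_c (J v) w = form_c v (J w).
  apply: (involution_selfadjoint pi_irr form_c_inv sigma_cK _ J2 Jpi) => g.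
  by rewrite !thetaE !multiplicativeV sigma_cK -sigmaC sigma_cK.
have [h hJ] := hermitian_of_selfadjoint Jadj.
have h_sign : signature pi [set g | theta g = g] h
    (leigenspace J 1) (leigenspace J (-1)).
  by apply: (signature_involution Jadj J2 _ hJ) => g v tg; rewrite Jpi tg.
have [v0 v0_neq0] := irreducible_neq0 pi_irr.
exists h; split=> //.
- by exists v0, (J v0); rewrite hJ J2 dnorm_eq0.
- by move=> g v w; rewrite !hJ form_c_inv Jpi thetaE !multiplicativeV
    -sigmaC sigmaK.
move=> P N h_sign'.
have [P1 N1] := leq_dim_signature h_sign h_sign'.
have [P2 N2] := leq_dim_signature h_sign' h_sign.
have -> : \dim P = \dim (leigenspace J 1) by apply/eqP; rewrite eqn_leq P2.
have -> : \dim N = \dim (leigenspace J (-1)) by apply/eqP; rewrite eqn_leq N2.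
by rewrite -lftrace_involution// /lftrace /J !linearZ.
Qed.

Lemma extension_of_form (h : {hermitian E for false & Num.conj}) :
    nonzero_form h -> invariant_form pi sigma h ->
  exists Pi : exG -> 'End(E), is_extension pi Pi.
Proof.
move=> [v1 [v2 h_neq0]] h_inv.
have [T hT] := sesquilinear_riesz form_c (hermitian_linearl h) (hermitian_linearr h).
have T_neq0 : T != 0.
  by apply: contra_neq h_neq0 => T0; rewrite hT T0 zero_lfunE dot0r.
have Tpi g v : T (pi g v) = pi (theta g) (T v).
  have := invariant_forms_intertwine form_c_inv h_inv hT (sigma g^-1%g) v.
  by rewrite sigmaK -!multiplicativeV invgK thetaE sigmaC.
have kerT := schur_lker0 pi_irr T_neq0 Tpi.
have thetaK g : theta (theta g) = g by rewrite !thetaE -sigmaC sigmaK sigma_cK.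
have [a Ta] : exists a, forall v, T (T v) = a *: v.
  have [a Ta] : exists a, forall v, (T \o T)%VF v = a *: v.
    by apply: (schur_scalar pi_irr) => g v; rewrite !comp_lfunE !Tpi thetaK.
  by exists a => v; rewrite -Ta comp_lfunE.
have [v0 v0_neq0] := irreducible_neq0 pi_irr.
have a_neq0 : a != 0.
  apply: contra_neq v0_neq0 => a0.
  by apply/(lker0P kerT)/(lker0P kerT); rewrite Ta a0 scale0r !linear0.
(* The scaling for which (l T)^2 = l^2 a = z_pi. *)
pose l := sqrtC (z_pi / a).
apply: (extension_of_intertwiner xi_out theta_Int xi2 (S := l *: T)) => //.
  by move=> g v; rewrite !scale_lfunE Tpi linearZ.
by move=> v; rewrite !scale_lfunE linearZ/= Ta pi_z !scalerA -expr2 sqrtCK divfK.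
Qed.

End ExtendedGroupForms.

Theorem corollary1p13 (R : realType) (G : algGroup R[i])
    (G_conn_red : connected_reductive G)
    (sigma sigma_c : {multiplicative G -> G})
    (sigma_real : real_form sigma)
    (sigma_c_compact : compact_real_form sigma_c)
    (sigmaC : forall g, sigma (sigma_c g) = sigma_c (sigma g))
    (theta : G -> G) (theta_def : theta = sigma \o sigma_c)
    (exG : extendedGroup G) (xi : exG) (z : G)
    (xi_out : ~ range (ex_incl exG) xi)
    (theta_Int : forall g,
       ex_incl exG (theta g) = (xi * ex_incl exG g * xi^-1)%g)
    (xi2 : (xi ^+ 2)%g = ex_incl exG z)
    (z_central : forall g, commute z g)
    (E : vectType R[i]) (pi : G -> 'End(E))
    (pi_alg : algebraic_rep pi) (pi_irr : irreducible pi)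
    (form_c : {dot E for Num.conj})
    (form_c_inv : invariant_form pi sigma_c form_c) :
  ((exists h : {hermitian E for false & Num.conj},
      nonzero_form h /\ invariant_form pi sigma h) <->
   (exists Pi : exG -> 'End(E), is_extension pi Pi)) /\
  (exists z_pi : R[i],
    [/\ z_pi != 0, pi z = z_pi *: \1%VF &
     forall Pi : exG -> 'End(E), is_extension pi Pi ->
     forall omega : R[i], omega ^+ 2 = z_pi ->
     let J : 'End(E) := omega^-1 *: Pi xi in
     exists h : {hermitian E for false & Num.conj},
       [/\ forall v w, h v w = form_c v (J w),
           nonzero_form h,
           invariant_form pi sigma h,
           signature pi [set g | theta g = g] h
             (passmx.leigenspace J 1) (passmx.leigenspace J (-1)) &
           forall P N : {vspace E}, signature pi [set g | theta g = g] h P N ->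
             (\dim P)%:R - (\dim N)%:R = omega^-1 * lftrace (Pi xi)]]).
Proof.
have pi_rep := pi_alg.1.
have sigmaK : involutive sigma := sigma_real.1.
have sigma_cK : involutive sigma_c := sigma_c_compact.1.1.
have thetaE g : theta g = sigma (sigma_c g) by rewrite theta_def.
have [z_pi z_pi_neq0 pi_z] := central_scalar pi_rep pi_irr z_central.
have form_of_ext := form_of_extension sigmaK sigma_cK sigmaC thetaE theta_Int
  xi2 pi_irr form_c_inv z_pi_neq0 pi_z.
split; last first.
  exists z_pi; split=> // [|Pi ext omega].
    by apply/lfunP=> v; rewrite pi_z scale_lfunE id_lfunE.
  exact: form_of_ext.
split=> [[h [h_neq0 h_inv]]|[Pi ext]].
  exact: (extension_of_form sigmaK sigma_cK sigmaC thetaE xi_out theta_Int xi2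
    pi_rep pi_irr form_c_inv pi_z h_neq0 h_inv).
have [h [_ h_neq0 h_inv _ _]] := form_of_ext Pi (sqrtC z_pi) ext (sqrtCK z_pi).
by exists h.
Qed.
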